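(* Let $(a,b,c)\in\{(1,2,15),(1,15,18),(1,15,30)\}$. Then for every positive even integer $n$, $$2t(a,b,c;n)=r\big(\langle a,b,c\rangle,\,4(8n+a+b+c)\big)-r\big(\langle a,b,c\rangle,\,8n+a+b+c\big).$$
   Context: For positive integers $a,b,c$ and an integer $n$, $t(a,b,c;n)$ denotes the number of $(x,y,z)\in\mathbb Z^3$ with $a\frac{x(x-1)}2+b\frac{y(y-1)}2+c\frac{z(z-1)}2=n$. $\langle a,b,c\rangle$ denotes the quadratic form $ax^2+by^2+cz^2$, and $r(h,m)$ denotes the number of integer vectors $v$ with $h(v)=m$. *)

(* Defs.v *)
From mathcomp Require Export all_boot all_order all_algebra.
From mathcomp Require Export finmap boolp classical_sets cardinality.
From mathcomp Require Import zify.

Set Implicit Arguments.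
Unset Strict Implicit.
Unset Printing Implicit Defensive.

Import Order.TTheory GRing.Theory Num.Theory.

Local Open Scope classical_set_scope.
Local Open Scope ring_scope.

Notation int3 := (int * int * int)%type.

(* [fset_set A] is empty when A is infinite; [tri_solutions_finite] and
   [diag_form_solutions_finite] below show that this junk value is not used
   for the sets counted here. *)
Definition card_sol (A : set int3) : nat := #|` fset_set A |.

(* The Euclidean division is exact: x * (x - 1) is even. *)
Definition tri (x : int) : int := (x * (x - 1) %/ 2)%Z.

Definition t (a b c n : int) : nat :=
  card_sol [set v : int3 | a * tri v.1.1 + b * tri v.1.2 + c * tri v.2 = n].

Definition r (h : int3 -> int) (m : int) : nat :=
  card_sol [set v : int3 | h v = m].

Definition diag_form (a b c : int) (v : int3) : int :=
  a * v.1.1 ^+ 2 + b * v.1.2 ^+ 2 + c * v.2 ^+ 2.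

Lemma triE (x : int) : 2 * tri x = x * (x - 1).
Proof. by rewrite /tri; case: (boolP (2 %| x)%Z); nia. Qed.

Lemma finite_box (N : nat) : finite_set [set x : int | `|x| <= N%:Z].
Proof.
apply: (@sub_finite_set _ _ ((fun k : nat => k%:Z - N%:Z) @` `I_(N.*2.+1))).
  by move=> x /= xN; exists (absz (x + N%:Z)); rewrite /=; lia.
exact/finite_image/finite_II.
Qed.

Lemma finite_bounded (A : set int3) (N : nat) :
  (forall v, A v -> [/\ `|v.1.1| <= N%:Z, `|v.1.2| <= N%:Z & `|v.2| <= N%:Z]) ->
  finite_set A.
Proof.
move=> AN; pose B := [set x : int | `|x| <= N%:Z].
apply: (@sub_finite_set _ _ ((B `*` B) `*` B)).
  by move=> v /AN[].
by apply: finite_setX; [apply: finite_setX|]; apply: finite_box.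
Qed.

Lemma diag_form_solutions_finite (a b c m : int) :
  0 < a -> 0 < b -> 0 < c -> finite_set [set v | diag_form a b c v = m].
Proof.
move=> a0 b0 c0; apply: (@finite_bounded _ (absz m)) => -[[x y] z].
rewrite /diag_form /= => <-.
have bnd (d w : int) : 0 < d -> `|w| <= d * w ^+ 2 by nia.
by have := (bnd _ x a0, bnd _ y b0, bnd _ z c0) => -[[? ?] ?]; split; lia.
Qed.

Lemma tri_solutions_finite (a b c n : int) :
  0 < a -> 0 < b -> 0 < c ->
  finite_set [set v : int3 | a * tri v.1.1 + b * tri v.1.2 + c * tri v.2 = n].
Proof.
move=> a0 b0 c0; apply: (@finite_bounded _ (absz n).+1) => -[[x y] z] /= <-.
have bnd (d w : int) : 0 < d -> `|w| <= d * tri w + 1 /\ 0 <= d * tri w.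
  move=> d0; have w2 := triE w.
  have w0 : 0 <= tri w by nia.
  have wt : `|w| <= tri w + 1 by nia.
  by split; nia.
have [? ?] := bnd _ x a0; have [? ?] := bnd _ y b0; have [? ?] := bnd _ z c0.
by split; lia.
Qed.

(* Main.v *)
Require Import Defs.
From mathcomp Require Import zify ring.

(* Up to a swap the form is x^2 + 15 z^2 + 2 e y^2 with e in {1, 9, 15}; put
   8 n + 16 + 2 e = 2 m, so that m = e mod 8.  Completing squares, t counts the
   all-odd solutions of x^2 + 15 z^2 + 2 e y^2 = 2 m.  Solutions of the equation
   with right-hand side 8 m and x even are twice the solutions for 2 m; the other
   ones have x, z odd and y even.  Among these,
   - those with y = 2 mod 4 correspond to the all-odd solutions for 2 m, through
     multiplication by an element of norm 4 of Z[(1 + sqrt(-15)) / 2];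
   - those with 4 | y correspond to the all-odd solutions of
     5 p^2 + 3 q^2 + e y^2 = m, through multiplication by a cube root of unity in
     a binary section of the form proportional to a^2 + 3 b^2, and these in turn
     to the all-odd solutions for 2 m.
   Each correspondence is linear only after a sign has been fixed by a congruence
   modulo 4 or 8, so both sides are first halved by a sign change. *)

Set Implicit Arguments.
Unset Strict Implicit.
Unset Printing Implicit Defensive.

Import Order.TTheory GRing.Theory Num.Theory.

Local Open Scope classical_set_scope.
Local Open Scope ring_scope.

(** * Comparing cardinalities of solution sets *)

Lemma card_sol_split (A P : set int3) : finite_set A ->
  card_sol A = (card_sol (A `&` P) + card_sol (A `&` ~` P))%N.
Proof.
move=> fA; rewrite /card_sol.
have fP : finite_set (A `&` P) by apply: sub_finite_set fA => v [].
have fQ : finite_set (A `&` ~` P) by apply: sub_finite_set fA => v [].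
have PQ0 : A `&` P `&` (A `&` ~` P) = classical_sets.set0.
  by apply/seteqP; split => // v [[_ ?] [_ ?]].
rewrite -{1}(classical_sets.setIT A) -(setUv P) classical_sets.setIUr.
by rewrite fset_setU // cardfsU -fset_setI // PQ0 fset_set0 cardfs0 subn0.
Qed.

(** A relation instead of a map allows correspondences given by integral linear equations with a
    factor 2 on one side, without division; choice turns [R] into an injection. *)
Lemma leq_card_sol (A B : set int3) (R : int3 -> int3 -> Prop) :
  finite_set A -> finite_set B ->
  (forall v, A v -> exists2 w, B w & R v w) ->
  (forall v v' w, R v w -> R v' w -> v = v') ->
  (card_sol A <= card_sol B)%N.
Proof.
move=> fA fB AB Rinj.
have /choice[f fP] v : exists w, A v -> B w /\ R v w.
  case: (pselect (A v)) => [/AB[w Bw Rvw]|nA]; first by exists w.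
  by exists v.
rewrite /card_sol -(card_in_imfset (imfset_key) (f := f) (p := mem (fset_set A))) /=.
  apply: fsubset_leq_card; apply/fsubsetP => _ /imfsetP[v /= + ->].
  by rewrite !in_fset_set // !inE => /fP[].
move=> v v'; rewrite !in_fset_set // !inE => /fP[_ Rv] /fP[_ Rv'] E.
by apply: Rinj Rv _; rewrite E.
Qed.

Lemma eq_card_sol_rel (A B : set int3) (R : int3 -> int3 -> Prop) :
  finite_set A -> finite_set B ->
  (forall v, A v -> exists2 w, B w & R v w) ->
  (forall w, B w -> exists2 v, A v & R v w) ->
  (forall v v' w, R v w -> R v' w -> v = v') ->
  (forall v w w', R v w -> R v w' -> w = w') ->
  card_sol A = card_sol B.
Proof.
move=> fA fB AB BA Rl Rr; apply/eqP; rewrite eqn_leq.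
rewrite (leq_card_sol fA fB AB Rl) /=.
apply: (@leq_card_sol _ _ (fun w v => R v w)) => // w w' v; exact: Rr.
Qed.

(** The involution exchanges the points of [A] inside [P] with those outside. This is how signs get
    fixed below. *)
Lemma card_sol_double (A P : set int3) (s : int3 -> int3) :
  finite_set A -> involutive s ->
  (forall v, A v -> A (s v)) -> (forall v, A v -> (P (s v) <-> ~ P v)) ->
  card_sol A = (card_sol (A `&` P)).*2.
Proof.
move=> fA sK As Ps; rewrite (card_sol_split P) // -addnn; congr addn.
apply: (@eq_card_sol_rel _ _ (fun v w => w = s v)).
- by apply: sub_finite_set fA => v [].
- by apply: sub_finite_set fA => v [].
- by move=> v [Av nPv]; exists (s v) => //; split; [exact: As|apply/(Ps v)].
- move=> w [Aw Pw]; exists (s w); last by rewrite sK.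
  by split; [exact: As|apply/(Ps (s w)); [exact: As|rewrite sK]].
- by move=> v v' w -> /(can_inj sK).
- by move=> v w w' -> ->.
Qed.

(** * Odd integers and their squares modulo powers of 2 *)

Definition isodd (x : int) : bool := ~~ (2 %| x)%Z.

Lemma odd_sqr (x : int) : isodd x -> exists k, x ^+ 2 = 8 * k + 1.
Proof.
rewrite /isodd => xo; have [h xE] : exists h, x = 2 * h + 1.
  by exists (x %/ 2)%Z; lia.
(* x^2 = 4 h (h + 1) + 1, and h (h + 1) / 2 is [tri (h + 1)]. *)
exists (tri (h + 1)); have := triE (h + 1); rewrite xE; nia.
Qed.

Lemma odd_Gauss (k : nat) (a b : int) :
  isodd a -> ((2 ^ k)%N%:Z %| a * b)%Z -> ((2 ^ k)%N%:Z %| b)%Z.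
Proof.
move=> ao; rewrite Gauss_dvdzr // /coprimez /gcdz /= eqz_nat.
rewrite -/(coprime _ _) coprimeXl // coprime2n; move: ao; rewrite /isodd; lia.
Qed.

(* One of the two even factors of x^2 - z^2 is twice an odd number. *)
Lemma odd_sqr_sub (k : nat) (x z : int) : isodd x -> isodd z ->
  ((2 ^ k.+2)%N%:Z %| x ^+ 2 - z ^+ 2)%Z ->
  ((2 ^ k.+1)%N%:Z %| x - z)%Z \/ ((2 ^ k.+1)%N%:Z %| x + z)%Z.
Proof.
rewrite /isodd => xo zo.
have [c cE] : exists c, x - z = 2 * c by exists ((x - z) %/ 2)%Z; lia.
have [d dE] : exists d, x + z = 2 * d by exists ((x + z) %/ 2)%Z; lia.
rewrite subr_sqr cE dE (_ : 2 * c * (2 * d) = 2 * (2 * (c * d))); last by ring.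
rewrite !expnS !PoszM !dvdz_mul2l //= => cd.
have [co|ce] := boolP (isodd c).
  by right; apply: odd_Gauss cd.
left; apply: (@odd_Gauss k d); last by rewrite mulrC.
by move: ce; rewrite /isodd; lia.
Qed.

(** * Solution sets and sign changes *)

Definition odd3 (v : int3) : bool := [&& isodd v.1.1, isodd v.1.2 & isodd v.2].

Definition flip2 (v : int3) : int3 := (v.1.1, - v.1.2, v.2).
Definition flip3 (v : int3) : int3 := (v.1.1, v.1.2, - v.2).

Lemma flip2K : involutive flip2.
Proof. by move=> [[x y] z]; rewrite /flip2 /= opprK. Qed.

Lemma flip3K : involutive flip3.
Proof. by move=> [[x y] z]; rewrite /flip3 /= opprK. Qed.

Lemma isoddN (x : int) : isodd (- x) = isodd x.
Proof. by rewrite /isodd; lia. Qed.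

Definition odd_sols (a b c m : int) : set int3 :=
  [set v | diag_form a b c v = m /\ odd3 v].

(** Triples are ordered (x, z, y): [v.2] is the variable with coefficient 2 e. *)
Definition sols_mod4 (i e m : int) : set int3 :=
  [set v | diag_form 1 15 (2 * e) v = m /\
           [/\ isodd v.1.1, isodd v.1.2 & (v.2 %% 4)%Z = i]].

Lemma finite_diag_subset (a b c m : int) (A : set int3) :
  0 < a -> 0 < b -> 0 < c -> (forall v, A v -> diag_form a b c v = m) ->
  finite_set A.
Proof.
move=> a0 b0 c0 AD; apply: sub_finite_set (diag_form_solutions_finite m a0 b0 c0).
exact: AD.
Qed.

(** Modulo 16 the equation reads x^2 = z^2, so 8 divides exactly one of x - z and x + z, and
    changing the sign of z exchanges the two cases. *)
Lemma odd_sols_half (e m : int) : (8 %| m - e)%Z -> 0 < e ->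
  card_sol (odd_sols 1 15 (2 * e) (2 * m)) =
  (card_sol (odd_sols 1 15 (2 * e) (2 * m) `&`
     [set v | (8 %| v.1.1 + v.1.2)%Z])).*2.
Proof.
move=> me e0; apply: (@card_sol_double _ _ flip2).
- by apply: (@finite_diag_subset 1 15 (2 * e) (2 * m)) => //; [lia|move=> v []].
- exact: flip2K.
- move=> [[x z] y]; rewrite /odd_sols /flip2 /odd3 /diag_form /= => -[<- ?].
  by rewrite isoddN; split => //; ring.
- move=> [[x z] y]; rewrite /odd_sols /odd3 /diag_form /=.
  move=> [E /and3P[xo zo yo]].
  have : ((2 ^ 4)%N%:Z %| x ^+ 2 - z ^+ 2)%Z.
    have [k yE] := odd_sqr yo; have [j mE] : exists j, m = 8 * j + e.
      by exists ((m - e) %/ 8)%Z; lia.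
    apply/dvdzP; exists (j - e * k - z ^+ 2); move: E.
    rewrite (_ : ((2 ^ 4)%N%:Z) = 16) // yE mE; lia.
  move=> /(odd_sqr_sub xo zo) /=.
  by rewrite (_ : (2 ^ 3)%N = 8%N) //; move: xo zo; rewrite /isodd; lia.
Qed.

(** * Solutions with y = 2 mod 4 *)

Lemma sols_2mod4_dvd (e m x z y : int) : (8 %| m - e)%Z ->
  sols_mod4 2 e (8 * m) (x, z, y) -> (32 %| x - 7 * z)%Z \/ (32 %| x + 7 * z)%Z.
Proof.
rewrite /sols_mod4 /diag_form /= => me [E [xo zo y2]].
(* 7 is a square root of -15 modulo 64, so x^2 + 15 z^2 becomes the difference x^2 - (7 z)^2. It
   vanishes modulo 64 because y / 2 is odd and m = e mod 8. *)
have zo7 : isodd (7 * z) by move: zo; rewrite /isodd; lia.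
apply: (@odd_sqr_sub 4) => //.
have [h yE] : exists h, y = 2 * h by exists (y %/ 2)%Z; lia.
have ho : isodd h by rewrite /isodd; lia.
have [k hE] := odd_sqr ho; have [j mE] : exists j, m = 8 * j + e.
  by exists ((m - e) %/ 8)%Z; lia.
apply/dvdzP; exists (j - e * k - z ^+ 2); move: E.
rewrite (_ : ((2 ^ 6)%N%:Z) = 64) // yE mE !exprMn hE; lia.
Qed.

(** As 7 = -1 mod 8, the condition 8 | x - z selects the sign x = -7 z modulo 32. *)
Lemma sols_2mod4_half (e m : int) : (8 %| m - e)%Z -> 0 < e ->
  card_sol (sols_mod4 2 e (8 * m)) =
  (card_sol (sols_mod4 2 e (8 * m) `&` [set v | (8 %| v.1.1 - v.1.2)%Z])).*2.
Proof.
move=> me e0; apply: (@card_sol_double _ _ flip2).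
- by apply: (@finite_diag_subset 1 15 (2 * e) (8 * m)) => //; [lia|move=> v []].
- exact: flip2K.
- move=> [[x z] y]; rewrite /sols_mod4 /flip2 /diag_form /= => -[<- [? ? ?]].
  by rewrite isoddN; split => //; ring.
- move=> [[x z] y] S; have := sols_2mod4_dvd me S; move: S.
  by rewrite /sols_mod4 /isodd /= => -[_ []]; lia.
Qed.

Lemma card_sols_2mod4 (e m : int) : (8 %| m - e)%Z -> 0 < e ->
  card_sol (sols_mod4 2 e (8 * m)) = card_sol (odd_sols 1 15 (2 * e) (2 * m)).
Proof.
move=> me e0; rewrite odd_sols_half // sols_2mod4_half //; congr double.
(* Up to conjugation, x + z sqrt(-15) is divided by (1 - sqrt(-15)) / 2, of
   norm 4. *)
apply: (@eq_card_sol_rel _ _ (fun w v => [/\ 2 * w.1.1 = v.1.1 + 15 * v.1.2,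
  2 * w.1.2 = v.1.1 - v.1.2 & w.2 = 2 * v.2])).
- by apply: (@finite_diag_subset 1 15 (2 * e) (8 * m)) => //; [lia|move=> v [[]]].
- by apply: (@finite_diag_subset 1 15 (2 * e) (2 * m)) => //; [lia|move=> v [[]]].
- move=> [[x z] y] [S /= P]; have := sols_2mod4_dvd me S; move: S.
  rewrite /odd_sols /sols_mod4 /odd3 /diag_form /= => -[E [xo zo y2]] dv.
  (* Divisibility by 32, not just by 8, makes the two new odd variables z + 4 k and 4 k - z add up
     to a multiple of 8. *)
  have [k xE] : exists k, x = 32 * k - 7 * z.
    by exists ((x + 7 * z) %/ 32)%Z; move: xo zo; rewrite /isodd; lia.
  have [h yE] : exists h, y = 2 * h by exists (y %/ 2)%Z; lia.
  exists (z + 4 * k, 4 * k - z, h) => /=; last by split; lia.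
  move: xo zo y2; rewrite /isodd yE => *.
  by split; [split; [move: E; rewrite xE yE; lia|lia]|lia].
- move=> [[x z] y]; rewrite /odd_sols /sols_mod4 /odd3 /diag_form /=.
  move=> [[E /and3P[xo zo yo]] /dvdzP[k kE]].
  have xE : x = k * 8 - z by lia.
  exists (7 * z + 4 * k, 4 * k - z, 2 * y); move: xo zo yo; rewrite /isodd /=;
    last by split; lia.
  by split; [split; [move: E; rewrite xE; lia|split; lia]|lia].
- by move=> [[? ?] ?] [[? ?] ?] [[? ?] ?] /= [? ? ?] [? ? ?]; congr (_, _, _); lia.
- by move=> [[? ?] ?] [[? ?] ?] [[? ?] ?] /= [? ? ?] [? ? ?]; congr (_, _, _); lia.
Qed.

(** * Passage to the form 5 p^2 + 3 q^2 + e y^2 *)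

Lemma card_odd_sols_5_3 (e m : int) : (8 %| m - e)%Z -> 0 < e ->
  card_sol (odd_sols 1 15 (2 * e) (2 * m)) = card_sol (odd_sols 5 3 e m).
Proof.
move=> me e0; rewrite odd_sols_half //.
(* For odd p and q, 4 divides exactly one of p + q and p - q. *)
have -> : card_sol (odd_sols 5 3 e m) =
    (card_sol (odd_sols 5 3 e m `&` [set v | (4 %| v.1.1 + v.1.2)%Z])).*2.
  apply: (@card_sol_double _ _ flip2).
  - by apply: (@finite_diag_subset 5 3 e m) => //; move=> v [].
  - exact: flip2K.
  - move=> [[p q] y]; rewrite /odd_sols /flip2 /odd3 /diag_form /= => -[<- ?].
    by rewrite isoddN; split => //; ring.
  - by move=> [[p q] y]; rewrite /odd_sols /odd3 /isodd /= => -[_]; lia.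
congr double.
(* 2 (5 p^2 + 3 q^2) = ((5 p + 3 q) / 2)^2 + 15 ((q - p) / 2)^2. *)
apply: (@eq_card_sol_rel _ _ (fun v w => [/\ 2 * v.1.1 = 5 * w.1.1 + 3 * w.1.2,
  2 * v.1.2 = w.1.2 - w.1.1 & v.2 = w.2])).
- by apply: (@finite_diag_subset 1 15 (2 * e) (2 * m)) => //; [lia|move=> v [[]]].
- by apply: (@finite_diag_subset 5 3 e m) => //; move=> v [[]].
- move=> [[x z] y]; rewrite /odd_sols /odd3 /diag_form /=.
  move=> [[E /and3P[xo zo yo]] /dvdzP[k kE]].
  have xE : x = k * 8 - z by lia.
  (* Solving the relation gives p = (x - 3 z) / 4 and q = (x + 5 z) / 4, where x = 8 k - z. *)
  exists (2 * k - z, 2 * k + z, y) => /=; last by split; lia.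
  move: xo zo yo; rewrite /isodd => *.
  by split; [split; [move: E; rewrite xE; lia|lia]|lia].
- move=> [[p q] y]; rewrite /odd_sols /odd3 /diag_form /=.
  move=> [[E /and3P[po qo yo]] /dvdzP[k kE]].
  have qE : q = k * 4 - p by lia.
  exists (p + 6 * k, 2 * k - p, y) => /=; last by split; lia.
  move: po qo yo; rewrite /isodd => *.
  by split; [split; [move: E; rewrite qE; lia|lia]|lia].
- by move=> [[? ?] ?] [[? ?] ?] [[? ?] ?] /= [? ? ?] [? ? ?]; congr (_, _, _); lia.
- by move=> [[? ?] ?] [[? ?] ?] [[? ?] ?] /= [? ? ?] [? ? ?]; congr (_, _, _); lia.
Qed.

(** * Solutions with 4 | y *)

Lemma sols_0mod4_half (e m : int) : 0 < e ->
  card_sol (sols_mod4 0 e (8 * m)) =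
  (card_sol (sols_mod4 0 e (8 * m) `&` [set v | (4 %| v.1.1 - v.1.2)%Z])).*2.
Proof.
move=> e0; apply: (@card_sol_double _ _ flip2).
- by apply: (@finite_diag_subset 1 15 (2 * e) (8 * m)) => //; [lia|move=> v []].
- exact: flip2K.
- move=> [[x z] y]; rewrite /sols_mod4 /flip2 /diag_form /= => -[<- [? ? ?]].
  by rewrite isoddN; split => //; ring.
- by move=> [[x z] y]; rewrite /sols_mod4 /isodd /= => -[_ []]; lia.
Qed.

(** With x = z + 4 v, the binary part divided by 8 is 2 z^2 + z v + 2 v^2, which p = (z + v) / 2 and
    q = (z - v) / 2 diagonalise. Both are integers since m odd forces v odd. *)
Lemma sols_0mod4_param (e m x z y : int) : isodd m ->
  sols_mod4 0 e (8 * m) (x, z, y) -> (4 %| x - z)%Z ->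
  exists p q h, [/\ x = 5 * p - 3 * q, z = p + q, y = 4 * h, isodd (p + q) &
                    5 * p ^+ 2 + 3 * q ^+ 2 + 4 * e * h ^+ 2 = m].
Proof.
move=> mo [/= E [xo zo y0]] /dvdzP[v vE].
have xE : x = z + 4 * v by lia.
have [h yE] : exists h, y = 4 * h by exists (y %/ 4)%Z; lia.
move: E; rewrite /diag_form /= xE yE => E.
have mE : m = z * v + 2 * (z ^+ 2 + v ^+ 2 + 2 * e * h ^+ 2) by lia.
have vo : isodd v.
  apply/negP => /dvdzP[w wE]; move: mo; rewrite /isodd mE wE.
  apply/negP; rewrite negbK; apply/dvdzP.
  by exists (z * w + (z ^+ 2 + (w * 2) ^+ 2 + 2 * e * h ^+ 2)); ring.
have [q qE] : exists q, z = v + 2 * q.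
  by exists ((z - v) %/ 2)%Z; move: zo vo; rewrite /isodd; lia.
exists (v + q), q, h; split; [lia|lia|lia| |rewrite mE qE; lia].
by move: vo; rewrite /isodd; lia.
Qed.

(** [P] is left open because the sign condition depends on e: it pairs y with q for e = 1 and 9,
    with p for e = 15. *)
Lemma odd_sols_5_3_half (e m : int) (P : set int3) : 0 < e ->
  (forall v, odd3 v -> (P (flip3 v) <-> ~ P v)) ->
  card_sol (odd_sols 5 3 e m) = (card_sol (odd_sols 5 3 e m `&` P)).*2.
Proof.
move=> e0 PN; apply: (@card_sol_double _ _ flip3).
- by apply: (@finite_diag_subset 5 3 e m) => //; move=> v [].
- exact: flip3K.
- move=> [[p q] y]; rewrite /odd_sols /flip3 /odd3 /diag_form /= => -[<- ?].
  by rewrite isoddN; split => //; ring.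
- by move=> v [_ /PN].
Qed.

Lemma sqr_parity (x : int) : exists k, x ^+ 2 = x + 2 * k.
Proof. by exists (tri x); have := triE x; lia. Qed.

Lemma even_or_odd (x : int) : (exists k, x = 2 * k) \/ isodd x.
Proof.
by rewrite /isodd; case: (boolP (2 %| x)%Z) => [/dvdzP[k ->]|];
  [left; exists k; lia|right].
Qed.

(* In all three lemmas below, 4 (a^2 + 3 b^2) with a + b odd is rewritten as
   (a + 3 b)^2 + 3 (a - b)^2, the norm of 2 (a + b sqrt(-3)) multiplied by a
   cube root of unity. *)
Lemma card_sols_0mod4_1 (m : int) : (8 %| m - 1)%Z ->
  card_sol (sols_mod4 0 1 (8 * m)) = card_sol (odd_sols 5 3 1 m).
Proof.
move=> me; rewrite sols_0mod4_half //.
rewrite (@odd_sols_5_3_half _ _ [set v | (4 %| v.1.2 + v.2)%Z]) //; last first.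
  by move=> [[p q] y]; rewrite /odd3 /isodd /=; lia.
congr double.
apply: (@eq_card_sol_rel _ _ (fun v w =>
  [/\ 2 * v.1.1 = 10 * w.1.1 + 3 * (w.1.2 + w.2),
      2 * v.1.2 = 2 * w.1.1 - (w.1.2 + w.2) & v.2 = 3 * w.1.2 - w.2])).
- by apply: (@finite_diag_subset 1 15 2 (8 * m)) => //; move=> v [[]].
- by apply: (@finite_diag_subset 5 3 1 m) => //; move=> v [[]].
- move=> [[x z] y] [S /= d4].
  have [|p [q [h [xE zE yE pq E]]]] := sols_0mod4_param _ S d4.
    by rewrite /isodd; lia.
  (* An even p would give m = 3 mod 4, against m = 1 mod 8. *)
  have [[a aE]|po] := even_or_odd p.
    have qo : isodd q by move: pq; rewrite /isodd aE; lia.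
    have [k kE] := odd_sqr qo; have [l lE] := sqr_parity a.
    by move: E me; rewrite aE kE !exprMn; lia.
  have [b bE] : exists b, q = 2 * b.
    by exists (q %/ 2)%Z; move: pq po; rewrite /isodd; lia.
  (* Modulo 8 the equation becomes 5 + 4 (b + h) = 1. *)
  have bh : isodd (b + h).
    have [k kE] := odd_sqr po.
    have [l lE] := sqr_parity b; have [n nE] := sqr_parity h.
    by move: E me; rewrite /isodd bE kE exprMn lE nE; lia.
  (* 3 q^2 + 4 h^2 = 4 (h^2 + 3 b^2) = 3 (h - b)^2 + (h + 3 b)^2; the sign makes the last two
     entries add up to -4 b. *)
  exists (p, h - b, - (h + 3 * b)) => /=; last by split; lia.
  rewrite /odd_sols /odd3 /diag_form /=; move: E po bh; rewrite /isodd bE => *.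
  by split; [split; lia|lia].
- move=> [[p q] y]; rewrite /odd_sols /odd3 /sols_mod4 /diag_form /=.
  move=> [[E /and3P[po qo yo]] /dvdzP[k kE]].
  have sE : q = k * 4 - y by lia.
  exists (5 * p + 6 * k, p - 2 * k, 12 * k - 4 * y) => /=; last by split; lia.
  move: po qo yo; rewrite /isodd => *.
  by split; [split; [move: E; rewrite sE; lia|split; lia]|lia].
- by move=> [[? ?] ?] [[? ?] ?] [[? ?] ?] /= [? ? ?] [? ? ?]; congr (_, _, _); lia.
- by move=> [[? ?] ?] [[? ?] ?] [[? ?] ?] /= [? ? ?] [? ? ?]; congr (_, _, _); lia.
Qed.

Lemma card_sols_0mod4_9 (m : int) : (8 %| m - 9)%Z ->
  card_sol (sols_mod4 0 9 (8 * m)) = card_sol (odd_sols 5 3 9 m).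
Proof.
move=> me; rewrite sols_0mod4_half //.
rewrite (@odd_sols_5_3_half _ _ [set v | (4 %| v.1.2 + v.2)%Z]) //; last first.
  by move=> [[p q] y]; rewrite /odd3 /isodd /=; lia.
congr double.
apply: (@eq_card_sol_rel _ _ (fun v w =>
  [/\ 2 * v.1.1 = 10 * w.1.1 - 3 * (3 * w.2 - w.1.2),
      2 * v.1.2 = 2 * w.1.1 + 3 * w.2 - w.1.2 & v.2 = - (w.2 + w.1.2)])).
- by apply: (@finite_diag_subset 1 15 18 (8 * m)) => //; move=> v [[]].
- by apply: (@finite_diag_subset 5 3 9 m) => //; move=> v [[]].
- move=> [[x z] y] [S /= d4].
  have [|p [q [h [xE zE yE pq E]]]] := sols_0mod4_param _ S d4.
    by rewrite /isodd; lia.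
  have [[a aE]|po] := even_or_odd p.
    have qo : isodd q by move: pq; rewrite /isodd aE; lia.
    have [k kE] := odd_sqr qo; have [l lE] := sqr_parity a.
    by move: E me; rewrite aE kE !exprMn; lia.
  have [b bE] : exists b, q = 2 * b.
    by exists (q %/ 2)%Z; move: pq po; rewrite /isodd; lia.
  have bh : isodd (b + h).
    have [k kE] := odd_sqr po.
    have [l lE] := sqr_parity b; have [n nE] := sqr_parity h.
    by move: E me; rewrite /isodd bE kE exprMn lE nE; lia.
  (* Here 3 q^2 + 36 h^2 = 12 (b^2 + 3 h^2) = 3 (b + 3 h)^2 + 9 (b - h)^2. *)
  exists (p, - (b + 3 * h), b - h) => /=; last by split; lia.
  rewrite /odd_sols /odd3 /diag_form /=; move: E po bh; rewrite /isodd bE => *.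
  by split; [split; lia|lia].
- move=> [[p q] y]; rewrite /odd_sols /odd3 /sols_mod4 /diag_form /=.
  move=> [[E /and3P[po qo yo]] /dvdzP[k kE]].
  have sE : q = k * 4 - y by lia.
  exists (5 * p - 6 * y + 6 * k, p + 2 * y - 2 * k, - (4 * k)) => /=; last by split; lia.
  move: po qo yo; rewrite /isodd => *.
  by split; [split; [move: E; rewrite sE; lia|split; lia]|lia].
- by move=> [[? ?] ?] [[? ?] ?] [[? ?] ?] /= [? ? ?] [? ? ?]; congr (_, _, _); lia.
- by move=> [[? ?] ?] [[? ?] ?] [[? ?] ?] /= [? ? ?] [? ? ?]; congr (_, _, _); lia.
Qed.

Lemma card_sols_0mod4_15 (m : int) : (8 %| m - 15)%Z ->
  card_sol (sols_mod4 0 15 (8 * m)) = card_sol (odd_sols 5 3 15 m).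
Proof.
move=> me; rewrite sols_0mod4_half //.
rewrite (@odd_sols_5_3_half _ _ [set v | (4 %| v.1.1 + v.2)%Z]) //; last first.
  by move=> [[p q] y]; rewrite /odd3 /isodd /=; lia.
congr double.
apply: (@eq_card_sol_rel _ _ (fun v w =>
  [/\ 2 * v.1.1 = 5 * (3 * w.2 - w.1.1) - 6 * w.1.2,
      2 * v.1.2 = 3 * w.2 - w.1.1 + 2 * w.1.2 & v.2 = - (w.2 + w.1.1)])).
- by apply: (@finite_diag_subset 1 15 30 (8 * m)) => //; move=> v [[]].
- by apply: (@finite_diag_subset 5 3 15 m) => //; move=> v [[]].
- move=> [[x z] y] [S /= d4].
  have [|p [q [h [xE zE yE pq E]]]] := sols_0mod4_param _ S d4.
    by rewrite /isodd; lia.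
  (* Now m = 3 mod 4, so q is the odd variable and p is the one mixed with h. *)
  have [[a aE]|qo] := even_or_odd q.
    have po : isodd p by move: pq; rewrite /isodd aE; lia.
    have [k kE] := odd_sqr po; have [l lE] := sqr_parity a.
    by move: E me; rewrite aE kE !exprMn; lia.
  have [b bE] : exists b, p = 2 * b.
    by exists (p %/ 2)%Z; move: pq qo; rewrite /isodd; lia.
  have bh : isodd (b + h).
    have [k kE] := odd_sqr qo.
    have [l lE] := sqr_parity b; have [n nE] := sqr_parity h.
    by move: E me; rewrite /isodd bE kE exprMn lE nE; lia.
  (* Here 5 p^2 + 60 h^2 = 20 (b^2 + 3 h^2) = 5 (b + 3 h)^2 + 15 (b - h)^2. *)
  exists (- (b + 3 * h), q, b - h) => /=; last by split; lia.
  rewrite /odd_sols /odd3 /diag_form /=; move: E qo bh; rewrite /isodd bE => *.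
  by split; [split; lia|lia].
- move=> [[p q] y]; rewrite /odd_sols /odd3 /sols_mod4 /diag_form /=.
  move=> [[E /and3P[po qo yo]] /dvdzP[k kE]].
  have sE : p = k * 4 - y by lia.
  exists (10 * y - 10 * k - 3 * q, 2 * y - 2 * k + q, - (4 * k)) => /=; last by split; lia.
  move: po qo yo; rewrite /isodd => *.
  by split; [split; [move: E; rewrite sE; lia|split; lia]|lia].
- by move=> [[? ?] ?] [[? ?] ?] [[? ?] ?] /= [? ? ?] [? ? ?]; congr (_, _, _); lia.
- by move=> [[? ?] ?] [[? ?] ?] [[? ?] ?] /= [? ? ?] [? ? ?]; congr (_, _, _); lia.
Qed.

(** * Expressing [t] and [r] by the solution sets *)

Lemma t_odd_sols (a b c n : int) : 0 < a -> 0 < b -> 0 < c ->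
  t a b c n = card_sol (odd_sols a b c (8 * n + a + b + c)).
Proof.
move=> a0 b0 c0; apply: (@eq_card_sol_rel _ _ (fun v w =>
  [/\ w.1.1 = 2 * v.1.1 - 1, w.1.2 = 2 * v.1.2 - 1 & w.2 = 2 * v.2 - 1])).
- exact: tri_solutions_finite.
- by apply: (@finite_diag_subset a b c (8 * n + a + b + c)) => //; move=> v [].
- move=> [[x y] z] /= <-; exists (2 * x - 1, 2 * y - 1, 2 * z - 1) => //.
  rewrite /odd_sols /odd3 /isodd /diag_form /=; split; last by lia.
  have sqE w : (2 * w - 1) ^+ 2 = 8 * tri w + 1 by have := triE w; lia.
  by rewrite !sqE; ring.
- move=> [[x y] z] [+ /and3P[]]; rewrite /isodd /diag_form /= => E xo yo zo.
  have half w : ~~ (2 %| w)%Z -> exists k, w = 2 * k - 1.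
    by exists ((w + 1) %/ 2)%Z; lia.
  have [i xE] := half _ xo; have [j yE] := half _ yo; have [k zE] := half _ zo.
  exists (i, j, k) => //=; move: E.
  have sqE w : (2 * w - 1) ^+ 2 = 8 * tri w + 1 by have := triE w; lia.
  by rewrite xE yE zE !sqE; lia.
- by move=> [[? ?] ?] [[? ?] ?] [[? ?] ?] /= [? ? ?] [? ? ?]; congr (_, _, _); lia.
- by move=> [[? ?] ?] [[? ?] ?] [[? ?] ?] /= [? ? ?] [? ? ?]; congr (_, _, _); lia.
Qed.

(** If x is even, congruences modulo 4 make z and y even, and halving gives a solution for 2 m. If x
    is odd, so is z; then 8 | x^2 + 15 z^2 forces y even, hence 0 or 2 modulo 4. *)
Lemma r_mul4 (e m : int) : 0 < e -> isodd e ->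
  r (diag_form 1 15 (2 * e)) (8 * m) =
  (r (diag_form 1 15 (2 * e)) (2 * m) +
   (card_sol (sols_mod4 0 e (8 * m)) + card_sol (sols_mod4 2 e (8 * m))))%N.
Proof.
move=> e0 eo; have e20 : 0 < 2 * e by lia.
have fin k A : (forall v, A v -> diag_form 1 15 (2 * e) v = k) -> finite_set A.
  exact: finite_diag_subset.
rewrite {1}/r (card_sol_split [set v | isodd v.1.1]); last exact: (fin (8 * m)).
rewrite addnC; congr addn; last rewrite (card_sol_split [set v | (4 %| v.2)%Z]).
- apply: (@eq_card_sol_rel _ _ (fun v w =>
    [/\ v.1.1 = 2 * w.1.1, v.1.2 = 2 * w.1.2 & v.2 = 2 * w.2])).
  + by apply: (fin (8 * m)) => v [].
  + exact: (fin (2 * m)).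
  + move=> [[x z] y]; rewrite /= /diag_form /= => -[E xe].
    have [[i xE]|//] := even_or_odd x.
    have [[j zE]|zo] := even_or_odd z; last first.
      by have [k kE] := odd_sqr zo; move: E; rewrite xE kE exprMn; lia.
    have [[k yE]|yo] := even_or_odd y; last first.
      have [k kE] := odd_sqr yo; move: E eo.
      by rewrite /isodd xE zE kE !exprMn; lia.
    exists (i, j, k) => //=; move: E; rewrite xE zE yE; lia.
  + move=> [[x z] y]; rewrite /diag_form /= => E.
    exists (2 * x, 2 * z, 2 * y) => //=; split; last by rewrite /isodd; lia.
    by rewrite !exprMn; lia.
  + by move=> [[? ?] ?] [[? ?] ?] [[? ?] ?] /= [? ? ?] [? ? ?]; congr (_, _, _); lia.
  + by move=> [[? ?] ?] [[? ?] ?] [[? ?] ?] /= [? ? ?] [? ? ?]; congr (_, _, _); lia.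
- have zy x z y : diag_form 1 15 (2 * e) (x, z, y) = 8 * m -> isodd x ->
      isodd z /\ (2 %| y)%Z.
    rewrite /diag_form /= => E xo; have [i iE] := odd_sqr xo.
    have [[j zE]|zo] := even_or_odd z.
      by move: E; rewrite iE zE exprMn; lia.
    split=> //; have [[k yE]|yo] := even_or_odd y; first by lia.
    have [j jE] := odd_sqr zo; have [k kE] := odd_sqr yo.
    by move: E eo; rewrite /isodd iE jE kE; lia.
  congr (card_sol _ + card_sol _)%N; apply/seteqP; split => -[[x z] y] /=.
  + by move=> [[E xo] y0]; have [zo ye] := zy _ _ _ E xo; split=> //; split=> //=; lia.
  + by move=> [E [/= xo zo y0]]; split=> //; lia.
  + move=> [[E xo] y0]; have [zo ye] := zy _ _ _ E xo; split=> //; split=> //=.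
    by move: y0; lia.
  + by move=> [E [/= xo zo y0]]; split=> //; lia.
- by apply: (fin (8 * m)) => v [].
Qed.

Lemma two_t_1_15_double (e n : int) : e \in [:: 1; 9; 15] -> (2 %| n)%Z ->
  2 * (t 1 15 (2 * e) n)%:Z =
    (r (diag_form 1 15 (2 * e)) (4 * (8 * n + 1 + 15 + 2 * e)))%:Z -
    (r (diag_form 1 15 (2 * e)) (8 * n + 1 + 15 + 2 * e))%:Z.
Proof.
move=> eE n2.
have [e0 eo] : 0 < e /\ isodd e by move: eE; rewrite !inE /isodd; lia.
(* The evenness of n enters here: 4 n is a multiple of 8. *)
pose m := 4 * n + 8 + e; have me : (8 %| m - e)%Z by rewrite /m; lia.
rewrite t_odd_sols //; last by lia.
have -> : 8 * n + 1 + 15 + 2 * e = 2 * m by rewrite /m; ring.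
have -> : 4 * (2 * m) = 8 * m by ring.
have S0 : card_sol (sols_mod4 0 e (8 * m)) = card_sol (odd_sols 5 3 e m).
  move: eE me; rewrite !inE => /or3P[] /eqP ->.
  - exact: card_sols_0mod4_1.
  - exact: card_sols_0mod4_9.
  - exact: card_sols_0mod4_15.
(* Each of the two classes of y modulo 4 has as many elements as [t] counts, whence the factor 2. *)
rewrite r_mul4 // S0 card_sols_2mod4 // -card_odd_sols_5_3 //; lia.
Qed.

(** * Exchanging the last two coefficients, and the three forms *)

Definition swap23 (v : int3) : int3 := (v.1.1, v.2, v.1.2).

Lemma card_sol_swap23 (A B : set int3) : finite_set A -> finite_set B ->
  (forall v, A v <-> B (swap23 v)) -> card_sol A = card_sol B.
Proof.
move=> fA fB AB; have sK : involutive swap23 by case=> -[].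
apply: (@eq_card_sol_rel _ _ (fun v w => w = swap23 v)) => //.
- by move=> v /AB Bv; exists (swap23 v).
- by move=> w Bw; exists (swap23 w); [apply/AB; rewrite sK|rewrite sK].
- by move=> v v' w -> /(can_inj sK).
- by move=> v w w' -> ->.
Qed.

Lemma t_swap23 (a b c n : int) : 0 < a -> 0 < b -> 0 < c ->
  t a b c n = t a c b n.
Proof.
move=> *; apply: card_sol_swap23; try exact: tri_solutions_finite.
by move=> [[x y] z] /=; split=> <-; ring.
Qed.

Lemma r_swap23 (a b c m : int) : 0 < a -> 0 < b -> 0 < c ->
  r (diag_form a b c) m = r (diag_form a c b) m.
Proof.
move=> *; apply: card_sol_swap23; try exact: diag_form_solutions_finite.
by move=> [[x y] z] /=; rewrite /diag_form /=; split=> <-; ring.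
Qed.

Theorem theorem3p7 (a b c : int) (n : int) :
  (a, b, c) \in [:: (1, 2, 15); (1, 15, 18); (1, 15, 30)] ->
  0 < n ->
  (2 %| n)%Z ->
  2 * (t a b c n)%:Z =
    (r (diag_form a b c) (4 * (8 * n + a + b + c)))%:Z -
    (r (diag_form a b c) (8 * n + a + b + c))%:Z.
Proof.
rewrite !inE => /or3P[] /eqP[-> -> ->] _ n2.
- rewrite t_swap23 // !(@r_swap23 1 2 15) //.
  rewrite (_ : 8 * n + 1 + 2 + 15 = 8 * n + 1 + 15 + 2 * 1); last by ring.
  exact: (@two_t_1_15_double 1).
- exact: (@two_t_1_15_double 9).
- exact: (@two_t_1_15_double 15).
Qed.
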